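(* Consider the uplink of a user-centric cell-free massive MIMO network with $L$ access points, $N$ antennas per access point and $K$ single-antenna users, with the model and notation of the context. Fix a user $k$, transmit powers $\eta_1,\dots,\eta_K>0$ and arbitrary local receive combiners. For an LSFD vector $\mathbf{a}_k\in\mathbb{C}^{|\mathcal{M}_k|}$ let $$\mathsf{SINR}_k(\mathbf{a}_k)=\frac{\eta_k\left|\mathbf{a}_k^{\mathrm H}\mathbb{E}\{\mathbf{g}_{kk}\}\right|^2}{\mathbf{a}_k^{\mathrm H}\mathbf{B}_k\mathbf{a}_k},\qquad \mathbf{B}_k=\sum_{i=1}^K\eta_i\,\mathbb{E}\{\mathbf{g}_{ki}\mathbf{g}_{ki}^{\mathrm H}\}-\eta_k\,\mathbb{E}\{\mathbf{g}_{kk}\}\mathbb{E}\{\mathbf{g}_{kk}^{\mathrm H}\}+\mathbf{F}_k .$$ Then $\mathbf{B}_k$ is positive definite. Hence the optimal LSFD vector, obtained by maximizing $\mathsf{SINR}_k(\mathbf{a}_k)$ over $\mathbf{a}_k$ as a generalized Rayleigh quotient, is $$\mathbf{a}_k^{\mathrm{opt}}=\mathbf{B}_k^{-1}\,\mathbb{E}\{\mathbf{g}_{kk}\},$$ which leads to the maximum value $$\mathsf{SINR}_k^{\mathrm{opt}}=\eta_k\,\mathbb{E}\{\mathbf{g}_{kk}^{\mathrm H}\}\,\mathbf{B}_k^{-1}\,\mathbb{E}\{\mathbf{g}_{kk}\}.$$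
   Context: $\mathbf{h}_{il}\sim\mathcal{N}_{\mathbb{C}}(\mathbf{0}_N,\mathbf{R}_{il})$ is the random channel in $\mathbb{C}^N$ between user $i$ and access point (AP) $l$, with spatial correlation matrix $\mathbf{R}_{il}$; channels corresponding to different APs are independent. $\mathcal{M}_k\subset\{1,\dots,L\}$ is the fixed subset of APs that serve user $k$, with ordered elements $l_{k1}<\dots<l_{k|\mathcal{M}_k|}$. AP $l$ computes minimum mean-squared error estimates $\widehat{\mathbf{h}}_{il}$ of the channels $\mathbf{h}_{il}$ from noisy received pilot signals. In the data phase AP $l$ receives $\sum_{i=1}^K\mathbf{h}_{il}\sqrt{\eta_i}s_i+\mathbf{n}_l$, where $s_i$ is the zero-mean unit-power information signal of user $i$, $\eta_i>0$ is its transmit power, and $\mathbf{n}_l\sim\mathcal{N}_{\mathbb{C}}(\mathbf{0}_N,\sigma^2\mathbf{I}_N)$ is noise of variance $\sigma^2$. For $l\in\mathcal{M}_k$, $\mathbf{v}_{kl}\in\mathbb{C}^N$ is the local receive combiner for user $k$ at AP $l$, selected arbitrarily based on the channel estimates $\{\widehat{\mathbf{h}}_{il}\}$ at that AP. Define $$\mathbf{g}_{ki}=[\mathbf{v}_{kl_{k1}}^{\mathrm H}\mathbf{h}_{il_{k1}},\dots,\mathbf{v}_{kl_{k|\mathcal{M}_k|}}^{\mathrm H}\mathbf{h}_{il_{k|\mathcal{M}_k|}}]^{\mathrm T}\in\mathbb{C}^{|\mathcal{M}_k|},$$ $$\mathbf{F}_k=\mathrm{diag}\left(\sigma^2\mathbb{E}\{\|\mathbf{v}_{kl_{k1}}\|^2\},\dots,\sigma^2\mathbb{E}\{\|\mathbf{v}_{kl_{k|\mathcal{M}_k|}}\|^2\}\right).$$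 LSFD stands for large-scale fading decoding: the vector $\mathbf{a}_k=[a_{kl_{k1}},\dots,a_{kl_{k|\mathcal{M}_k|}}]^{\mathrm T}$ contains the deterministic weights with which the central processing unit forms $\sum_{l\in\mathcal{M}_k}a_{kl}^*\widehat{s}_{kl}$ from the local data estimates $\widehat{s}_{kl}$ ($\mathbf{v}_{kl}^{\mathrm H}$ times the signal received at AP $l$). The quantity $\mathsf{SINR}_k$ is the effective signal-to-interference-plus-noise ratio of user $k$. The superscript $\mathrm H$ denotes conjugate transpose.
   Formalization: The local combiners of the serving access points are assumed not almost surely zero (otherwise B_k has a zero row and is not positive definite) and such that E‖v_kl‖² and E|v_kl^H h_il|² are finite, so that the expectations in B_k exist. *)

(* Defs.v *)
From HB Require Import structures.
From mathcomp Require Import all_boot all_order all_algebra complex.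
From mathcomp Require Import all_classical all_reals all_analysis.

Set Implicit Arguments.
Unset Strict Implicit.
Unset Printing Implicit Defensive.

Import Order.TTheory GRing.Theory Num.Theory.
Import numFieldNormedType.Exports.

Local Open Scope classical_set_scope.
Local Open Scope ring_scope.
Local Open Scope complex_scope.
Local Open Scope sesquilinear_scope.

(* The order on [R[i]] is the partial one ([0 <= z] iff [z] is real and *)
(* nonnegative), so these formulas also assert that [x^H A x] is real. *)
Definition pos_semidef (C : numClosedFieldType) n (A : 'M[C]_n) :=
  A \is hermsymmx /\ forall x : 'cV[C]_n, 0 <= (x ^t* *m A *m x) 0 0.

Definition pos_def (C : numClosedFieldType) n (A : 'M[C]_n) :=
  A \is hermsymmx /\ forall x : 'cV[C]_n, x != 0 -> 0 < (x ^t* *m A *m x) 0 0.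

Section ComplexRandom.
Context {R : realType} {d : measure_display} {T : measurableType d}.
Variable P : probability T R.

Definition cexpect (Z : T -> R[i]) : R[i] :=
  fine 'E_P[fun w => complex.Re (Z w)] +i* fine 'E_P[fun w => complex.Im (Z w)].

Definition mxexpect m n (X : T -> 'M[R[i]]_(m, n)) : 'M[R[i]]_(m, n) :=
  \matrix_(i, j) cexpect (fun w => X w i j).

Definition sqnorm n (u : 'cV[R[i]]_n) : R :=
  \sum_i (complex.Re (u i 0) ^+ 2 + complex.Im (u i 0) ^+ 2).

(* The sigma-algebra generated by a family of complex-valued functions; [R[i]] *)
(* carries no measurable structure, hence the real and imaginary parts. *)
Definition csigma (J : Type) (Z : J -> T -> R[i]) : set (set T) :=
  <<s [set A | exists j (B : set R), measurable B /\
         (A = (fun w => complex.Re (Z j w)) @^-1` B \/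
          A = (fun w => complex.Im (Z j w)) @^-1` B)] >>.

Definition mxsigmas (J : Type) m n (X : J -> T -> 'M[R[i]]_(m, n)) :=
  csigma (fun (p : J * ('I_m * 'I_n)) w => X p.1 w p.2.1 p.2.2).

Definition mxsigma m n (X : T -> 'M[R[i]]_(m, n)) := mxsigmas (fun _ : unit => X).

(* Mutual independence; the events [A i] may be [setT], so that the product *)
(* rule for all subfamilies is included. *)
Definition independent (J : finType) (S : J -> set (set T)) :=
  forall A : J -> set T, (forall j, S j (A j)) ->
    P (\bigcap_j A j) = (\prod_j P (A j))%E.

(* [normal_prob 0 0] is not the Dirac mass at 0. *)
Definition centered_normal (s2 : R) (B : set R) : \bar R :=
  if s2 == 0 then \d_(0 : R) B else normal_prob 0 (Num.sqrt s2) B.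

(* The law N_C(0, S) (circularly symmetric): for every [c] the real variable *)
(* Re(c^H X) is normal with mean 0 and variance c^H S c / 2. *)
Definition complex_gaussian n (S : 'M[R[i]]_n) (X : T -> 'cV[R[i]]_n) :=
  [/\ mxsigma X `<=` measurable, pos_semidef S &
    forall (c : 'cV[R[i]]_n) (B : set R), measurable B ->
      P ((fun w => complex.Re ((c ^t* *m X w) 0 0)) @^-1` B) =
      centered_normal (complex.Re ((c ^t* *m S *m c) 0 0) / 2) B].

(* [X'] is a minimum mean-squared error estimate of [X] from [Y]. *)
Definition mmse_estimate n m p (X : T -> 'cV[R[i]]_n) (Y : T -> 'M[R[i]]_(m, p))
    (X' : T -> 'cV[R[i]]_n) :=
  mxsigma X' `<=` mxsigma Y /\
  forall X'' : T -> 'cV[R[i]]_n, mxsigma X'' `<=` mxsigma Y ->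
    ('E_P[fun w => sqnorm (X w - X' w)] <= 'E_P[fun w => sqnorm (X w - X'' w)])%E.

(* The pilot transmission is left unspecified: [pilot_rx l] is whatever random *)
(* observation AP [l] receives before the data phase. *)
Record uplink (L N K tau : nat) := Uplink {
  corr : 'I_K -> 'I_L -> 'M[R[i]]_N;
  channel : 'I_K -> 'I_L -> T -> 'cV[R[i]]_N;
  channel_law : forall i l, complex_gaussian (corr i l) (channel i l);
  channel_indep : independent (fun l => mxsigmas (fun i => channel i l));
  serving : 'I_K -> {set 'I_L};
  pilot_rx : 'I_L -> T -> 'M[R[i]]_(N, tau);
  pilot_rx_meas : forall l, mxsigma (pilot_rx l) `<=` measurable;
  estimate : 'I_K -> 'I_L -> T -> 'cV[R[i]]_N;
  estimate_mmse : forall i l,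
    mmse_estimate (channel i l) (pilot_rx l) (estimate i l);
  power : 'I_K -> R;
  power_gt0 : forall i, 0 < power i;
  noise_var : R;
  noise_var_gt0 : 0 < noise_var;
  noise : 'I_L -> T -> 'cV[R[i]]_N;
  noise_law : forall l, complex_gaussian (noise_var%:C)%:M (noise l);
  signal : 'I_K -> T -> R[i];
  signal_meas : forall i, csigma (fun _ : unit => signal i) `<=` measurable;
  signal_mean : forall i, cexpect (signal i) = 0;
  signal_power : forall i, cexpect (fun w => `|signal i w| ^+ 2) = 1;
  data_rx : 'I_L -> T -> 'cV[R[i]]_N;
  data_rxE : forall l w, data_rx l w =
    \sum_i ((Num.sqrt (power i))%:C * signal i w) *: channel i l w + noise l w
}.

Section LSFD.
Variables (L N K tau : nat) (net : uplink L N K tau).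
Variables (k : 'I_K) (v : 'I_L -> T -> 'cV[R[i]]_N).

Local Notation M := (serving net k).

(* [v l] is the combiner of user [k] at AP [l]; only [l \in M] matters. The *)
(* two integrability conditions say that the second moments occurring in [Bmx] *)
(* exist, and the last condition excludes combiners vanishing almost surely. *)
Definition local_combiner :=
  forall l, l \in M ->
  [/\ mxsigma (v l) `<=` mxsigmas (fun i => estimate net i l),
      P.-integrable setT (fun w => (sqnorm (v l w))%:E),
      (forall i, P.-integrable setT
         (fun w => (sqnorm ((v l w) ^t* *m channel net i l w))%:E)) &
      ~ (\forall w \ae P, v l w = 0)].

(* [enum_val] lists the elements of [M] in increasing order. *)
Definition gvec (i : 'I_K) (w : T) : 'cV[R[i]]_#|M| :=
  \col_j ((v (enum_val j) w) ^t* *m channel net i (enum_val j) w) 0 0.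

Definition Fmx : 'M[R[i]]_#|M| :=
  diag_mx (\row_j (noise_var net *
                   fine 'E_P[fun w => sqnorm (v (enum_val j) w)])%:C).

Definition Bmx : 'M[R[i]]_#|M| :=
  \sum_i (power net i)%:C *: mxexpect (fun w => gvec i w *m (gvec i w) ^t*)
  - (power net k)%:C *:
      (mxexpect (gvec k) *m mxexpect (fun w => (gvec k w) ^t*))
  + Fmx.

(* When the denominator is 0 the value is 0, by the convention on division. *)
Definition SINR (a : 'cV[R[i]]_#|M|) : R[i] :=
  (power net k)%:C * `|(a ^t* *m mxexpect (gvec k)) 0 0| ^+ 2
  / (a ^t* *m Bmx *m a) 0 0.

Definition lsfd_opt : 'cV[R[i]]_#|M| := invmx Bmx *m mxexpect (gvec k).

End LSFD.
End ComplexRandom.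

Arguments gvec {R d T P L N K tau} net k v i w.
Arguments Fmx {R d T P L N K tau} net k v.
Arguments Bmx {R d T P L N K tau} net k v.
Arguments SINR {R d T P L N K tau} net k v a.
Arguments lsfd_opt {R d T P L N K tau} net k v.
Arguments local_combiner {R d T P L N K tau} net k v.

(* Main.v *)
Require Import Defs.
From mathcomp Require Import all_boot all_order all_algebra complex.
From mathcomp Require Import all_classical all_reals all_analysis.
From mathcomp Require Import measurable_realfun ring.

(* With m = E{g_kk}, the matrix B_k is the sum of the second-moment matrices  *)
(* eta_i E{g_ki g_ki^H} for i <> k, of eta_k times the covariance matrix      *)
(* E{(g_kk - m) (g_kk - m)^H}, and of F_k.  The first two are positive        *)
(* semidefinite because x^H E{g g^H} x = E|x^H g|^2, and F_k is positive      *)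
(* definite because no combiner vanishes almost surely.  Writing c = B^-1 m,  *)
(* so that a^H m = a^H B c, the Cauchy-Schwarz inequality for the inner       *)
(* product defined by B bounds |a^H m|^2 / (a^H B a) by c^H B c = m^H B^-1 m, *)
(* with equality at a = c.                                                    *)

Import Order.TTheory GRing.Theory Num.Theory.

Set Implicit Arguments.
Unset Strict Implicit.
Unset Printing Implicit Defensive.

Local Open Scope ring_scope.
Local Open Scope sesquilinear_scope.

(** The algebra is independent of the probability: for positive definite B, [rayleigh_le] draws the
    bound from [pos_def_cauchy], and [rayleigh_invmx] computes the maximal value; the SINR is the
    power of user [k] times this quotient. The probabilistic input is [gvec_Lfun2]: the entries of
    each g_ki are square integrable. First moments and pairwise products are then integrable, so
    [mxexpect] is linear and commutes with conjugate transposition. This yields [second_moment_psd]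
    and [covariance_mxE]. With the latter, [BmxE] turns the difference defining B_k into a sum of
    positive semidefinite terms and F_k, and [Fmx_pos_def] supplies strictness. *)

(** * Positive definite matrices and the generalized Rayleigh quotient *)

Section PositiveDefinite.
Variable C : numClosedFieldType.

Lemma trmxC_mul m n p (A : 'M[C]_(m, n)) (B : 'M[C]_(n, p)) :
  (A *m B) ^t* = B ^t* *m A ^t*.
Proof. by rewrite trmx_mul map_mxM. Qed.

Lemma trmxCD m n (A B : 'M[C]_(m, n)) : (A + B) ^t* = A ^t* + B ^t*.
Proof. by rewrite linearD map_mxD. Qed.

Lemma trmxCN m n (A : 'M[C]_(m, n)) : (- A) ^t* = - A ^t*.
Proof. by rewrite linearN map_mxN. Qed.

Lemma trmxCZ m n a (A : 'M[C]_(m, n)) : (a *: A) ^t* = a^* *: A ^t*.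
Proof. by rewrite linearZ map_mxZ. Qed.

Lemma hermsymmxP n (A : 'M[C]_n) : reflect (A ^t* = A) (A \is hermsymmx).
Proof.
(* The general notion carries a sign (-1)^b; here b is 0. *)
by rewrite is_hermitianmxE expr0 scale1r eq_sym; apply: eqP.
Qed.

Lemma hermsymmxD n (A B : 'M[C]_n) :
  A \is hermsymmx -> B \is hermsymmx -> A + B \is hermsymmx.
Proof.
by move=> /hermsymmxP hA /hermsymmxP hB; apply/hermsymmxP; rewrite trmxCD hA hB.
Qed.

Lemma pos_semidef0 n : pos_semidef (0 : 'M[C]_n).
Proof.
split; first by apply/hermsymmxP; rewrite trmx0 map_mx0.
by move=> x; rewrite mulmx0 mul0mx mxE.
Qed.

Lemma pos_semidefD n (A B : 'M[C]_n) :
  pos_semidef A -> pos_semidef B -> pos_semidef (A + B).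
Proof.
move=> [hA pA] [hB pB]; split; first exact: hermsymmxD.
by move=> x; rewrite mulmxDr mulmxDl mxE addr_ge0.
Qed.

Lemma pos_semidef_sum (I : Type) (r : seq I) (Q : pred I) n (A : I -> 'M[C]_n) :
  (forall i, Q i -> pos_semidef (A i)) ->
  pos_semidef (\sum_(i <- r | Q i) A i).
Proof.
by move=> hA; apply: big_ind => //; [exact: pos_semidef0|exact: pos_semidefD].
Qed.

Lemma pos_semidefZ n a (A : 'M[C]_n) :
  0 <= a -> pos_semidef A -> pos_semidef (a *: A).
Proof.
move=> a0 [/hermsymmxP hA pA]; split.
  by apply/hermsymmxP; rewrite trmxCZ hA geC0_conj.
by move=> x; rewrite -scalemxAr -scalemxAl mxE mulr_ge0.
Qed.

Lemma pos_semidef_pos_defD n (A B : 'M[C]_n) :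
  pos_semidef A -> pos_def B -> pos_def (A + B).
Proof.
move=> [hA pA] [hB pB]; split; first exact: hermsymmxD.
by move=> x x0; rewrite mulmxDr mulmxDl mxE ltr_wpDl ?pB.
Qed.

(** The form at x is the sum of the u_j |x_j|^2, and some x_j is nonzero. *)
Lemma pos_def_diag n (u : 'rV[C]_n) :
  (forall j, 0 < u 0 j) -> pos_def (diag_mx u).
Proof.
move=> u0; split.
  apply/hermsymmxP; rewrite tr_diag_mx map_diag_mx; congr diag_mx.
  apply/rowP => j; rewrite mxE; exact/geC0_conj/ltW.
move=> x /cV0Pn[j xj]; rewrite mul_mx_diag mxE (bigD1 j) //=.
have t i : (\matrix_(a, b) ((x ^t*) a b * u 0 b)) 0 i * x i 0 =
    u 0 i * `|x i 0| ^+ 2.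
  by rewrite !mxE normCK mulrAC [RHS]mulrC [_^* * _]mulrC.
rewrite t ltr_wpDr ?mulr_gt0 ?exprn_gt0 ?normr_gt0 //.
by apply: sumr_ge0 => i _; rewrite t mulr_ge0 ?exprn_ge0 // ltW.
Qed.

(** A nonzero row u with u A = 0 would make the form vanish at the nonzero vector u^H. *)
Lemma pos_def_unitmx n (A : 'M[C]_n) : pos_def A -> A \in unitmx.
Proof.
move=> [hA pA]; rewrite -row_free_unit -kermx_eq0; apply: contraT.
case/rowV0Pn => u /sub_kermxP uA u0.
have : 0 < (u ^t* ^t* *m A *m u ^t*) 0 0.
  apply: pA; apply: contra u0 => /eqP u0.
  by rewrite -[u]trmxCK u0 trmx0 map_mx0.
by rewrite trmxCK uA mul0mx mxE ltxx.
Qed.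

Lemma hermsymmx_formC n (A : 'M[C]_n) (x y : 'cV[C]_n) : A \is hermsymmx ->
  (y ^t* *m A *m x) 0 0 = ((x ^t* *m A *m y) 0 0)^*.
Proof.
move=> /hermsymmxP hA.
transitivity (((x ^t* *m A *m y) ^t*) 0 0); last by rewrite !mxE.
by rewrite !trmxC_mul trmxCK hA mulmxA.
Qed.

(** The form is nonnegative at q x - conj(r) y, where its value is q (p q - |r|^2); dividing by q >
    0 gives the claim. *)
Lemma pos_def_cauchy n (A : 'M[C]_n) (x y : 'cV[C]_n) : pos_def A ->
  `|(x ^t* *m A *m y) 0 0| ^+ 2 <=
  (x ^t* *m A *m x) 0 0 * (y ^t* *m A *m y) 0 0.
Proof.
move=> [hA pA]; have [->|y0] := eqVneq y 0.
  by rewrite !mulmx0 mxE normr0 expr0n /= mulr0.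
have q0 := pA y y0; set q := (y ^t* *m A *m y) 0 0 in q0 *.
set r := (x ^t* *m A *m y) 0 0; set p := (x ^t* *m A *m x) 0 0.
have pS (z : 'cV[C]_n) : 0 <= (z ^t* *m A *m z) 0 0.
  have [->|z0] := eqVneq z 0; first by rewrite mulmx0 mxE.
  exact/ltW/pA.
(* Up to scaling, this is the component of [x] that is [A]-orthogonal to [y]. *)
have := pS (q *: x - r^* *: y).
rewrite -scaleNr trmxCD !trmxCZ rmorphN /= conjCK (geC0_conj (ltW q0)).
have -> : ((q *: x ^t* + - r *: y ^t*) *m A *m (q *: x + - r^* *: y)) 0 0 =
   q * (p * q - `|r| ^+ 2).
  rewrite !mulmxDl !mulmxDr -!scalemxAl -!scalemxAr.
  have E (u v : 'M[C]_1) : (u + v) 0 0 = u 0 0 + v 0 0 by rewrite mxE.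
  have EZ a (u : 'M[C]_1) : (a *: u) 0 0 = a * u 0 0 by rewrite mxE.
  rewrite !(E, EZ) (hermsymmx_formC x y hA) -/p -/q -/r normCK.
  ring.
by rewrite pmulr_rge0 // subr_ge0.
Qed.

(** The SINR without its power factor, with the same value 0 at [a = 0]. *)
Definition rayleigh n (B : 'M[C]_n) (b a : 'cV[C]_n) : C :=
  `|(a ^t* *m b) 0 0| ^+ 2 / (a ^t* *m B *m a) 0 0.

(** Substituting b = B c gives (B c)^H c = c^H B c, the factor that Cauchy-Schwarz produces. *)
Lemma invmx_formE n (B : 'M[C]_n) (b : 'cV[C]_n) :
  B \is hermsymmx -> B \in unitmx ->
  b ^t* *m invmx B *m b = (invmx B *m b) ^t* *m B *m (invmx B *m b).
Proof.
move=> hB uB; set c := invmx B *m b.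
have bE : b = B *m c by rewrite mulKVmx.
by rewrite -mulmxA -/c {1}bE trmxC_mul (hermsymmxP _ hB).
Qed.

Lemma rayleigh_invmx n (B : 'M[C]_n) (b : 'cV[C]_n) : pos_def B ->
  rayleigh B b (invmx B *m b) = (b ^t* *m invmx B *m b) 0 0.
Proof.
move=> pB; have uB := pos_def_unitmx pB; have [hB pB'] := pB.
set c := invmx B *m b; have bE : b = B *m c by rewrite mulKVmx.
rewrite /rayleigh invmx_formE // -/c {1}bE mulmxA.
(* For c = 0 the quotient is 0 / 0 = 0, which is also the value of the form. *)
have [c0|c0] := eqVneq c 0; first by rewrite c0 !mulmx0 mxE invr0 mulr0.
have q0 := pB' _ c0.
by rewrite ger0_norm ?ltW // expr2 mulfK // gt_eqF.
Qed.

Lemma rayleigh_le n (B : 'M[C]_n) (b a : 'cV[C]_n) : pos_def B ->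
  rayleigh B b a <= rayleigh B b (invmx B *m b).
Proof.
move=> pB; have uB := pos_def_unitmx pB; have [hB pB'] := pB.
rewrite rayleigh_invmx //; set c := invmx B *m b.
have bE : b = B *m c by rewrite mulKVmx.
rewrite invmx_formE // -/c /rayleigh {1}bE mulmxA.
(* At a = 0 the quotient is 0 by convention, so only c^H B c >= 0 is left to check. *)
have [->|a0] := eqVneq a 0.
  rewrite !mulmx0 [X in _ / X]mxE invr0 mulr0.
  have [->|c0] := eqVneq c 0; first by rewrite mulmx0 mxE.
  exact/ltW/pB'.
by rewrite ler_pdivrMr ?pB' // mulrC pos_def_cauchy.
Qed.

End PositiveDefinite.

Local Open Scope complex_scope.

(** * Integrability and expectation of complex random variables and matrices *)

Section ComplexExpectation.
Context {R : realType} {d : measure_display} {T : measurableType d}.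
Variable P : probability T R.
Implicit Types (Z W : T -> R[i]) (c : R[i]).

Lemma Lfun2_of_sqr (f : T -> R) : measurable_fun setT f ->
  P.-integrable setT (fun w => (f w ^+ 2)%:E) -> f \in Lfun P 2%:E.
Proof.
move=> mf /integrableP[_ f2]; rewrite inE; apply/andP; split; rewrite inE //=.
rewrite /finite_norm unlock /Lnorm poweR_lty //.
apply: le_lt_trans f2; rewrite le_eqVlt; apply/orP; left; apply/eqP.
by apply: eq_integral => w _ /=; rewrite normrX powR_mulrn.
Qed.

(** Componentwise, to match [cexpect]: for p = 1 both real expectations are finite, so [fine] loses
    nothing; for p = 2 products are integrable. *)
Definition cLfun (p : \bar R) Z :=
  (fun w => complex.Re (Z w)) \in Lfun P p /\
  (fun w => complex.Im (Z w)) \in Lfun P p.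

Lemma cLfunD (p : \bar R) Z W : (1 <= p)%E ->
  cLfun p Z -> cLfun p W -> cLfun p (fun w => Z w + W w).
Proof.
move=> p1 [Zr Zi] [Wr Wi]; split.
  have -> : (fun w => complex.Re (Z w + W w)) =
     (fun w => complex.Re (Z w)) + (fun w => complex.Re (W w)).
    by apply/funext => w /=; rewrite raddfD.
  exact: rpredD.
have -> : (fun w => complex.Im (Z w + W w)) =
   (fun w => complex.Im (Z w)) + (fun w => complex.Im (W w)).
  by apply/funext => w /=; rewrite raddfD.
exact: rpredD.
Qed.

Lemma cLfun_conj (p : \bar R) Z : (1 <= p)%E ->
  cLfun p Z -> cLfun p (fun w => Num.conj (Z w)).
Proof.
move=> p1 [Zr Zi]; split.
  by have -> : (fun w => complex.Re (Num.conj (Z w))) =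
     (fun w => complex.Re (Z w)) by apply/funext => w /=; case: (Z w).
have -> : (fun w => complex.Im (Num.conj (Z w))) =
   - (fun w => complex.Im (Z w)).
  by apply/funext => w; rewrite fctE; case: (Z w).
by rewrite rpredN.
Qed.

(** An equality of functions, in the shape to which [Lfun_scale] and [expectationZl] apply. *)
Lemma ReMl c Z : (fun w => complex.Re (c * Z w)) =
  complex.Re c \o* (fun w => complex.Re (Z w)) +
  (- complex.Im c) \o* (fun w => complex.Im (Z w)).
Proof.
apply/funext => w; case: c => a b; rewrite /= !fctE /=; case: (Z w) => u v /=.
ring.
Qed.

Lemma ImMl c Z : (fun w => complex.Im (c * Z w)) =
  complex.Re c \o* (fun w => complex.Im (Z w)) +
  complex.Im c \o* (fun w => complex.Re (Z w)).
Proof.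
apply/funext => w; case: c => a b; rewrite /= !fctE /=; case: (Z w) => u v /=.
ring.
Qed.

Lemma cLfun1Zl c Z : cLfun 1 Z -> cLfun 1 (fun w => c * Z w).
Proof.
move=> [Zr Zi].
by split; rewrite (ReMl, ImMl); apply: rpredD; apply: Lfun_scale.
Qed.

Lemma cLfun_cst (r : R) c : cLfun r%:E (fun _ : T => c).
Proof. by split; apply: Lfun_cst. Qed.

(** Each of the four real products is integrable by the Hölder inequality. *)
Lemma cLfun2_mul Z W : cLfun 2%:E Z -> cLfun 2%:E W ->
  cLfun 1 (fun w => Z w * W w).
Proof.
move=> [Zr Zi] [Wr Wi]; split.
  have -> : (fun w => complex.Re (Z w * W w)) =
     (fun w => complex.Re (Z w)) \* (fun w => complex.Re (W w)) -
     (fun w => complex.Im (Z w)) \* (fun w => complex.Im (W w)).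
    by apply/funext => w; rewrite !fctE /=; case: (Z w) (W w) => [a b] [u v].
  by apply: rpredB; apply: Lfun2_mul_Lfun1.
have -> : (fun w => complex.Im (Z w * W w)) =
   (fun w => complex.Re (Z w)) \* (fun w => complex.Im (W w)) +
   (fun w => complex.Im (Z w)) \* (fun w => complex.Re (W w)).
  by apply/funext => w; rewrite !fctE /=; case: (Z w) (W w) => [a b] [u v].
by apply: rpredD; apply: Lfun2_mul_Lfun1.
Qed.

Lemma cLfun_sum (p : \bar R) (I : Type) (r : seq I) (Z : I -> T -> R[i]) :
  (1 <= p)%E -> (forall i, cLfun p (Z i)) ->
  cLfun p (fun w => \sum_(i <- r) Z i w).
Proof.
move=> p1 hZ; elim: r => [|i r IH].
  have -> : (fun w => \sum_(i <- [::]) Z i w) = fun=> 0.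
    by apply/funext => w; rewrite big_nil.
  by split; rewrite -[X in X \in _]/(0 : T -> R) rpred0.
have -> : (fun w => \sum_(j <- i :: r) Z j w) =
    fun w => Z i w + \sum_(j <- r) Z j w.
  by apply/funext => w; rewrite big_cons.
exact: cLfunD.
Qed.

Lemma cLfun2_1 Z : cLfun 2%:E Z -> cLfun 1 Z.
Proof.
move=> [Zr Zi].
by split; apply: (Lfun_subset12 (fin_num_measure P _ measurableT)).
Qed.

Lemma cexpectD Z W : cLfun 1 Z -> cLfun 1 W ->
  cexpect P (fun w => Z w + W w) = cexpect P Z + cexpect P W.
Proof.
move=> [Zr Zi] [Wr Wi]; rewrite /cexpect.
have -> : (fun w => complex.Re (Z w + W w)) =
   (fun w => complex.Re (Z w)) \+ (fun w => complex.Re (W w)).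
  by apply/funext => w /=; rewrite raddfD.
have -> : (fun w => complex.Im (Z w + W w)) =
   (fun w => complex.Im (Z w)) \+ (fun w => complex.Im (W w)).
  by apply/funext => w /=; rewrite raddfD.
by rewrite !expectationD // !fineD ?expectation_fin_num.
Qed.

Lemma cexpectZl c Z : cLfun 1 Z ->
  cexpect P (fun w => c * Z w) = c * cexpect P Z.
Proof.
move=> [Zr Zi]; rewrite /cexpect ReMl ImMl.
rewrite !expectationD ?Lfun_scale //.
rewrite !expectationZl // !fineD ?fin_numM ?expectation_fin_num //.
rewrite !fineM ?expectation_fin_num //=.
by case: c => a b; simpc.
Qed.

Lemma cexpect_conj Z : cLfun 1 Z ->
  cexpect P (fun w => Num.conj (Z w)) = Num.conj (cexpect P Z).
Proof.
move=> [Zr Zi]; rewrite /cexpect.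
have -> : (fun w => complex.Re (Num.conj (Z w))) =
   (fun w => complex.Re (Z w)) by apply/funext => w /=; case: (Z w).
have -> : (fun w => complex.Im (Num.conj (Z w))) =
   (-1) \o* (fun w => complex.Im (Z w)).
  by apply/funext => w /=; case: (Z w) => a b /=; rewrite mulrN1.
by rewrite expectationZl // EFinN mulN1e fineN.
Qed.

Lemma cexpect_cst c : cexpect P (fun=> c) = c.
Proof.
have cstE (r : R) : 'E_P[fun=> r]%E = r%:E by exact: expectation_cst.
by rewrite /cexpect !cstE; case: c.
Qed.

Lemma cexpect_sum (I : Type) (r : seq I) (Z : I -> T -> R[i]) :
  (forall i, cLfun 1 (Z i)) ->
  cexpect P (fun w => \sum_(i <- r) Z i w) = \sum_(i <- r) cexpect P (Z i).
Proof.
move=> hZ; elim: r => [|i r IH].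
  rewrite big_nil -[RHS]cexpect_cst; congr cexpect.
  by apply/funext => w; rewrite big_nil.
rewrite big_cons -IH -cexpectD //; last exact: cLfun_sum.
by congr cexpect; apply/funext => w; rewrite big_cons.
Qed.

Lemma cexpect_ge0 Z : (forall w, 0 <= Z w) -> 0 <= cexpect P Z.
Proof.
(* In the partial order of [R[i]], a nonnegative number is real. *)
move=> Z0; have Zri w : complex.Im (Z w) = 0 /\ 0 <= complex.Re (Z w).
  by have := Z0 w; rewrite lecE /= => /andP[/eqP].
rewrite lecE /=; apply/andP; split; last first.
  by apply/fine_ge0/expectation_ge0 => w; have [] := Zri w.
have -> : (fun w => complex.Im (Z w)) = cst 0.
  by apply/funext => w; have [] := Zri w.
by rewrite expectation_cst.
Qed.

Definition mxLfun (p : \bar R) m n (X : T -> 'M[R[i]]_(m, n)) :=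
  forall i j, cLfun p (fun w => X w i j).

Lemma mxLfunD (p : \bar R) m n (X Y : T -> 'M[R[i]]_(m, n)) : (1 <= p)%E ->
  mxLfun p X -> mxLfun p Y -> mxLfun p (fun w => X w + Y w).
Proof.
move=> p1 hX hY i j.
have -> : (fun w => (X w + Y w) i j) = fun w => X w i j + Y w i j.
  by apply/funext => w; rewrite mxE.
exact: cLfunD.
Qed.

Lemma mxLfun_cst (r : R) m n (A : 'M[R[i]]_(m, n)) :
  mxLfun r%:E (fun _ : T => A).
Proof. by move=> i j; apply: cLfun_cst. Qed.

Lemma mxLfun_trC (p : \bar R) m n (X : T -> 'M[R[i]]_(m, n)) : (1 <= p)%E ->
  mxLfun p X -> mxLfun p (fun w => X w ^t*).
Proof.
move=> p1 hX i j.
have -> : (fun w => (X w ^t*) i j) = fun w => Num.conj (X w j i).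
  by apply/funext => w; rewrite !mxE.
exact: cLfun_conj.
Qed.

Lemma mxLfun1_mulmxl m n q (A : 'M[R[i]]_(m, n)) (X : T -> 'M[R[i]]_(n, q)) :
  mxLfun 1 X -> mxLfun 1 (fun w => A *m X w).
Proof.
move=> hX i j.
have -> : (fun w => (A *m X w) i j) = fun w => \sum_l A i l * X w l j.
  by apply/funext => w; rewrite mxE.
by apply: cLfun_sum => // l; apply: cLfun1Zl.
Qed.

Lemma mxLfun1_mulmxr m n q (X : T -> 'M[R[i]]_(m, n)) (A : 'M[R[i]]_(n, q)) :
  mxLfun 1 X -> mxLfun 1 (fun w => X w *m A).
Proof.
move=> hX i j.
have -> : (fun w => (X w *m A) i j) = fun w => \sum_l A l j * X w i l.
  by apply/funext => w; rewrite mxE; apply: eq_bigr => l _; rewrite mulrC.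
by apply: cLfun_sum => // l; apply: cLfun1Zl.
Qed.

Lemma mxLfun2_mulmx m n q
    (X : T -> 'M[R[i]]_(m, n)) (Y : T -> 'M[R[i]]_(n, q)) :
  mxLfun 2%:E X -> mxLfun 2%:E Y -> mxLfun 1 (fun w => X w *m Y w).
Proof.
move=> hX hY i j.
have -> : (fun w => (X w *m Y w) i j) = fun w => \sum_l X w i l * Y w l j.
  by apply/funext => w; rewrite mxE.
by apply: cLfun_sum => // l; apply: cLfun2_mul.
Qed.

Lemma mxLfun2_1 m n (X : T -> 'M[R[i]]_(m, n)) : mxLfun 2%:E X -> mxLfun 1 X.
Proof. by move=> hX i j; apply: cLfun2_1. Qed.

Lemma mxexpectD m n (X Y : T -> 'M[R[i]]_(m, n)) : mxLfun 1 X -> mxLfun 1 Y ->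
  mxexpect P (fun w => X w + Y w) = mxexpect P X + mxexpect P Y.
Proof.
move=> hX hY; apply/matrixP => i j; rewrite !mxE -cexpectD //.
by congr cexpect; apply/funext => w; rewrite mxE.
Qed.

Lemma mxexpect_cst m n (A : 'M[R[i]]_(m, n)) : mxexpect P (fun=> A) = A.
Proof. by apply/matrixP => i j; rewrite mxE cexpect_cst. Qed.

Lemma mxexpect_mulmxl m n q (A : 'M[R[i]]_(m, n)) (X : T -> 'M[R[i]]_(n, q)) :
  mxLfun 1 X -> mxexpect P (fun w => A *m X w) = A *m mxexpect P X.
Proof.
move=> hX; apply/matrixP => i j; rewrite !mxE.
under eq_bigr => l _ do rewrite mxE -cexpectZl //.
rewrite -cexpect_sum; last by move=> l; apply: cLfun1Zl.
by congr cexpect; apply/funext => w; rewrite mxE.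
Qed.

Lemma mxexpect_mulmxr m n q (X : T -> 'M[R[i]]_(m, n)) (A : 'M[R[i]]_(n, q)) :
  mxLfun 1 X -> mxexpect P (fun w => X w *m A) = mxexpect P X *m A.
Proof.
move=> hX; apply/matrixP => i j; rewrite !mxE.
under eq_bigr => l _ do rewrite mxE mulrC -cexpectZl //.
rewrite -cexpect_sum; last by move=> l; apply: cLfun1Zl.
congr cexpect; apply/funext => w; rewrite mxE.
by apply: eq_bigr => l _; rewrite mulrC.
Qed.

Lemma mxexpect_trC m n (X : T -> 'M[R[i]]_(m, n)) : mxLfun 1 X ->
  mxexpect P (fun w => X w ^t*) = (mxexpect P X) ^t*.
Proof.
move=> hX; apply/matrixP => i j; rewrite !mxE -cexpect_conj //.
by congr cexpect; apply/funext => w; rewrite !mxE.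
Qed.

(** By linearity x^H and x move inside the expectation, where the integrand becomes |x^H X|^2. *)
Lemma second_moment_psd n (X : T -> 'cV[R[i]]_n) : mxLfun 2%:E X ->
  pos_semidef (mxexpect P (fun w => X w *m X w ^t*)).
Proof.
move=> hX.
have hXX : mxLfun 1 (fun w => X w *m X w ^t*).
  by apply: mxLfun2_mulmx => //; apply: mxLfun_trC => //; rewrite lee_fin ler1n.
split.
  apply/hermsymmxP; rewrite -mxexpect_trC //; congr mxexpect.
  by apply/funext => w; rewrite trmxC_mul trmxCK.
move=> x; rewrite -mxexpect_mulmxl // -mxexpect_mulmxr; last first.
  exact: mxLfun1_mulmxl.
rewrite mxE; apply: cexpect_ge0 => w.
have -> : x ^t* *m (X w *m X w ^t*) *m x =
    (x ^t* *m X w) *m (x ^t* *m X w) ^t*.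
  by rewrite trmxC_mul trmxCK !mulmxA.
by rewrite mxE big_ord1 !mxE -normCK exprn_ge0.
Qed.

Lemma covariance_mxE n (X : T -> 'cV[R[i]]_n) : mxLfun 2%:E X ->
  mxexpect P (fun w => (X w - mxexpect P X) *m (X w - mxexpect P X) ^t*) =
  mxexpect P (fun w => X w *m X w ^t*) -
  mxexpect P X *m mxexpect P (fun w => X w ^t*).
Proof.
move=> hX; have hX1 := mxLfun2_1 hX; have hXt := mxLfun_trC (lexx _) hX1.
have l12 : (1 <= 2%:E :> \bar R)%E by rewrite lee_fin ler1n.
have hXX : mxLfun 1 (fun w => X w *m X w ^t*).
  by apply: mxLfun2_mulmx => //; apply: mxLfun_trC.
rewrite mxexpect_trC //; set m := mxexpect P X.
(* With this grouping the second bracket has expectation - m m^H + m m^H = 0, and the first one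
   gives the claim. *)
have -> : (fun w => (X w - m) *m (X w - m) ^t*) = fun w =>
    (X w *m X w ^t* + X w *m (- m ^t*)) + ((- m) *m X w ^t* + m *m m ^t*).
  apply/funext => w; rewrite trmxCD trmxCN mulmxDr !mulmxDl addrACA.
  by rewrite !mulNmx !mulmxN opprK.
rewrite !mxexpectD; try by do ?[exact: mxLfun_cst | exact: mxLfun1_mulmxr |
  exact: mxLfun1_mulmxl | apply: mxLfunD].
rewrite mxexpect_mulmxr // mxexpect_mulmxl // mxexpect_cst mxexpect_trC // -/m.
by rewrite mulmxN mulNmx addNr addr0.
Qed.

End ComplexExpectation.

(** * Measurability, and moments of squared norms *)

Section Measurability.
Context {R : realType} {d : measure_display} {T : measurableType d}.
Local Open Scope classical_set_scope.

Definition cmeasurable (Z : T -> R[i]) :=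
  measurable_fun setT (fun w => complex.Re (Z w)) /\
  measurable_fun setT (fun w => complex.Im (Z w)).

Lemma csigma_cmeasurable (J : Type) (Z : J -> T -> R[i]) j :
  csigma Z `<=` measurable -> cmeasurable (Z j).
Proof.
move=> hZ; split => _ B mB; rewrite setTI; apply: hZ; apply: sub_gen_smallest.
  by exists j, B; split => //; left.
by exists j, B; split => //; right.
Qed.

Lemma mxsigma_cmeasurable m n (X : T -> 'M[R[i]]_(m, n)) i j :
  mxsigma X `<=` measurable -> cmeasurable (fun w => X w i j).
Proof. by move=> hX; apply: (csigma_cmeasurable (tt, (i, j)) hX). Qed.

(** Each generator for the family involves a single member, and is thus measurable. *)
Lemma mxsigmas_measurable (J : Type) m n (X : J -> T -> 'M[R[i]]_(m, n)) :
  (forall j, mxsigma (X j) `<=` measurable) -> mxsigmas X `<=` measurable.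
Proof.
move=> hX; apply: smallest_sub; first exact: sigma_algebra_measurable.
move=> A [[j [a b]]] [B [mB AE]].
have [mr mi] := mxsigma_cmeasurable a b (hX j).
by case: AE => -> /=; rewrite -[X in measurable X]setTI; [apply: mr|apply: mi].
Qed.

Lemma cmeasurable_conj Z : cmeasurable Z ->
  cmeasurable (fun w => Num.conj (Z w)).
Proof.
move=> [mr mi]; split.
  by have -> : (fun w => complex.Re (Num.conj (Z w))) =
     (fun w => complex.Re (Z w)) by apply/funext => w /=; case: (Z w).
have -> : (fun w => complex.Im (Num.conj (Z w))) =
   \- (fun w => complex.Im (Z w)) by apply/funext => w /=; case: (Z w).
exact: measurableT_comp.
Qed.

Lemma cmeasurableM Z W : cmeasurable Z -> cmeasurable W ->
  cmeasurable (fun w => Z w * W w).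
Proof.
move=> [Zr Zi] [Wr Wi]; split.
  have -> : (fun w => complex.Re (Z w * W w)) =
     (fun w => complex.Re (Z w)) \* (fun w => complex.Re (W w)) \-
     (fun w => complex.Im (Z w)) \* (fun w => complex.Im (W w)).
    by apply/funext => w /=; case: (Z w) (W w) => [a b] [u v].
  by apply: measurable_funB; apply: measurable_funM.
have -> : (fun w => complex.Im (Z w * W w)) =
   (fun w => complex.Re (Z w)) \* (fun w => complex.Im (W w)) \+
   (fun w => complex.Im (Z w)) \* (fun w => complex.Re (W w)).
  by apply/funext => w /=; case: (Z w) (W w) => [a b] [u v].
by apply: measurable_funD; apply: measurable_funM.
Qed.

Lemma cmeasurable_sum (I : Type) (r : seq I) (Z : I -> T -> R[i]) :
  (forall i, cmeasurable (Z i)) -> cmeasurable (fun w => \sum_(i <- r) Z i w).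
Proof.
move=> hZ; split.
  under eq_fun do rewrite raddf_sum.
  by apply: measurable_sum => i; have [] := hZ i.
under eq_fun do rewrite raddf_sum.
by apply: measurable_sum => i; have [] := hZ i.
Qed.

Variable P : probability T R.

(** The squares of the real and imaginary parts are both dominated by |Z|^2. *)
Lemma cLfun2_of_sqr Z : cmeasurable Z ->
  P.-integrable setT
    (fun w => (complex.Re (Z w) ^+ 2 + complex.Im (Z w) ^+ 2)%:E) ->
  cLfun P 2%:E Z.
Proof.
move=> [mr mi] hZ.
split; apply: Lfun2_of_sqr => //; apply: le_integrable hZ => //.
- exact/measurable_EFinP/measurable_funX.
- move=> w _; rewrite lee_fin !ger0_norm ?addr_ge0 ?sqr_ge0 //.
  by rewrite lerDl sqr_ge0.
- exact/measurable_EFinP/measurable_funX.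
- move=> w _; rewrite lee_fin !ger0_norm ?addr_ge0 ?sqr_ge0 //.
  by rewrite lerDr sqr_ge0.
Qed.

Lemma sqnorm_ge0 n (u : 'cV[R[i]]_n) : 0 <= sqnorm u.
Proof. by apply: sumr_ge0 => i _; rewrite addr_ge0 ?sqr_ge0. Qed.

Lemma sqnorm_eq0 n (u : 'cV[R[i]]_n) : sqnorm u = 0 -> u = 0.
Proof.
move=> /eqP; rewrite /sqnorm psumr_eq0; last first.
  by move=> i _; rewrite addr_ge0 ?sqr_ge0.
move=> /allP u0; apply/colP => i; rewrite mxE.
have := u0 i (mem_index_enum i); rewrite /= paddr_eq0 ?sqr_ge0 // !sqrf_eq0.
by case: (u i 0) => a b /= /andP[/eqP -> /eqP ->].
Qed.

(** A nonnegative function with zero integral vanishes almost everywhere. *)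
Lemma expect_sqnorm_gt0 n (X : T -> 'cV[R[i]]_n) :
  P.-integrable setT (fun w => (sqnorm (X w))%:E) ->
  ~ (\forall w \ae P, X w = 0) -> 0 < fine 'E_P[fun w => sqnorm (X w)].
Proof.
move=> iX X0; rewrite lt_def; apply/andP; split; last first.
  by apply/fine_ge0/expectation_ge0 => w; apply: sqnorm_ge0.
apply/eqP => EX0; apply: X0.
have /integrableP[mX _] := iX.
have : (\int[P]_w `|(sqnorm (X w))%:E|)%E = 0%E.
  under eq_integral do rewrite gee0_abs ?lee_fin ?sqnorm_ge0 //.
  move: EX0; rewrite unlock => EX0.
  (* [fine] also sends infinity to 0; integrability excludes that case. *)
  by rewrite -[LHS]fineK ?EX0 //; apply: integrable_fin_num.
move=> /(ae_eq_integral_abs P measurableT mX); apply: filterS => w /= /(_ I) [].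
exact: sqnorm_eq0.
Qed.

End Measurability.

(** * The matrix B_k of the network *)

Section Network.
Context {R : realType} {d : measure_display} {T : measurableType d}.
Variable P : probability T R.
Variables (L N K tau : nat) (net : uplink P L N K tau).
Variables (k : 'I_K) (v : 'I_L -> T -> 'cV[R[i]]_N).
Hypothesis hv : local_combiner net k v.

(** The combiner is a function of the estimates, which are functions of the measurable pilot
    observation. *)
Lemma combiner_cmeasurable l i j : l \in serving net k ->
  cmeasurable (fun w => v l w i j).
Proof.
move=> lM; apply: mxsigma_cmeasurable; have [hl _ _ _] := hv lM.
apply: (subset_trans hl); apply: mxsigmas_measurable => u.
have [hest _] := estimate_mmse net u l.
exact: subset_trans (hest) (@pilot_rx_meas _ _ _ _ _ _ _ _ net l).
Qed.

Lemma gvec_Lfun2 i : mxLfun P 2%:E (gvec net k v i).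
Proof.
move=> j j0; rewrite (ord1 j0) {j0}.
have lM : enum_val j \in serving net k by apply: enum_valP.
set l := enum_val j in lM.
have -> : (fun w => gvec net k v i w j 0) =
    fun w => (v l w ^t* *m channel net i l w) 0 0.
  by apply/funext => w; rewrite mxE.
apply: cLfun2_of_sqr; last first.
  (* On a 1 x 1 matrix [sqnorm] is the squared modulus of the entry, so the combiner condition is
     the one wanted. *)
  have [_ _ /(_ i) + _] := hv lM; congr (_.-integrable _ _).
  by apply/funext => w; rewrite /sqnorm big_ord1.
have -> : (fun w => (v l w ^t* *m channel net i l w) 0 0) =
    fun w => \sum_a Num.conj (v l w a 0) * channel net i l w a 0.
  by apply/funext => w; rewrite mxE; apply: eq_bigr => a _; rewrite !mxE.
apply: cmeasurable_sum => a; apply: cmeasurableM.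
  exact/cmeasurable_conj/combiner_cmeasurable.
by apply: mxsigma_cmeasurable; have [] := channel_law net i l.
Qed.

Lemma Fmx_pos_def : pos_def (Fmx net k v).
Proof.
apply: pos_def_diag => j; rewrite mxE ltcR mulr_gt0 ?noise_var_gt0 //.
have lM : enum_val j \in serving net k by apply: enum_valP.
by have [_ hi _ h0] := hv lM; apply: expect_sqnorm_gt0.
Qed.

(** The term i = k of the sum absorbs the subtracted product of means and becomes a covariance, so
    no difference of semidefinite matrices remains. *)
Lemma BmxE : Bmx net k v =
  (\sum_(i | i != k) (power net i)%:C *:
     mxexpect P (fun w => gvec net k v i w *m (gvec net k v i w) ^t*) +
   (power net k)%:C *: mxexpect P (fun w =>
     (gvec net k v k w - mxexpect P (gvec net k v k)) *m
     (gvec net k v k w - mxexpect P (gvec net k v k)) ^t*))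
  + Fmx net k v.
Proof.
rewrite covariance_mxE; last exact: gvec_Lfun2.
rewrite /Bmx (bigD1 k) //= scalerBr; congr (_ + _).
by rewrite [X in X - _]addrC addrA.
Qed.

Lemma Bmx_pos_def : pos_def (Bmx net k v).
Proof.
have p0 i : 0 <= (power net i)%:C by rewrite lecR ltW ?power_gt0.
rewrite BmxE; apply: pos_semidef_pos_defD; last exact: Fmx_pos_def.
apply: pos_semidefD.
  apply: pos_semidef_sum => i _; apply: pos_semidefZ => //.
  by apply: second_moment_psd; apply: gvec_Lfun2.
apply: pos_semidefZ => //; apply: second_moment_psd.
apply: mxLfunD; [by rewrite lee_fin ler1n|exact: gvec_Lfun2|].
exact: mxLfun_cst.
Qed.

End Network.

Theorem mainTheorem2 (R : realType) (d : measure_display)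
    (T : measurableType d) (P : probability T R) (L N K tau : nat)
    (net : uplink P L N K tau) (k : 'I_K) (v : 'I_L -> T -> 'cV[R[i]]_N)
    (v_combiner : local_combiner net k v) :
  [/\ pos_def (Bmx net k v),
      forall a : 'cV[R[i]]_#|serving net k|,
        SINR net k v a <= SINR net k v (lsfd_opt net k v),
      mxexpect P (gvec net k v k) != 0 -> lsfd_opt net k v != 0 &
      SINR net k v (lsfd_opt net k v) =
        (power net k)%:C *
        (mxexpect P (fun w => (gvec net k v k w) ^t*)
         *m invmx (Bmx net k v) *m mxexpect P (gvec net k v k)) 0 0].
Proof.
have pB := Bmx_pos_def v_combiner; have uB := pos_def_unitmx pB.
have SINR_E a : SINR net k v a =
    (power net k)%:C * rayleigh (Bmx net k v) (mxexpect P (gvec net k v k)) a.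
  by rewrite /SINR /rayleigh [RHS]mulrA.
split => //.
- move=> a; rewrite !SINR_E ler_wpM2l ?rayleigh_le //.
  by rewrite lecR ltW ?power_gt0.
(* If B^-1 m = 0, then m = B (B^-1 m) = 0. *)
- apply: contra => /eqP o0.
  by rewrite -[mxexpect _ _](mulKVmx uB) -/(lsfd_opt net k v) o0 mulmx0.
(* The quotient yields E{g}^H where the formula has E{g^H}; they agree because g_kk is
   integrable. *)
- rewrite SINR_E rayleigh_invmx // mxexpect_trC //.
  exact/mxLfun2_1/(gvec_Lfun2 v_combiner).
Qed.
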